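(* Let $\mathsf{L}\in\mathbb{R}^{N\times N}$ be invertible, $\mathsf{G}=\mathsf{L}^{-1}$, with SVD $\{\hat\lambda_i,\hat{\mathsf{u}}_i,\hat{\mathsf{v}}_i\}_{i=1}^N$ as in the context, and let $n\le N$. The discrete Kolmogorov $n$-width optimization problem $$\mathcal{K}_n(\mathsf{G})=\min_{\mathsf{V}_n\in\mathbb{R}^{N\times n}}\max_{\mathsf{f}\in\mathbb{R}^N,\,\mathsf{f}\neq0}\min_{\mathsf{c}\in\mathbb{R}^n}\frac{\|\mathsf{G}\mathsf{f}-\mathsf{G}\mathsf{V}_n\mathsf{c}\|_2}{\|\mathsf{f}\|_2}\qquad(\mathrm{K})$$ and the Bayesian variance minimization problem $$\hat{\mathsf{M}}\in\operatorname*{argmin}_{\mathsf{M}\in\mathbb{R}^{N\times n},\ \mathrm{rank}(\mathsf{M})=n}\mathrm{Tr}\left[\mathsf{C}-\mathsf{K}^\top\mathsf{\Theta}^{-1}\mathsf{K}\right]=\operatorname*{argmax}_{\mathsf{M}\in\mathbb{R}^{N\times n},\ \mathrm{rank}(\mathsf{M})=n}\mathrm{Tr}\left[\mathsf{K}^\top\mathsf{\Theta}^{-1}\mathsf{K}\right]\qquad(\mathrm{B})$$ are equivalent in the following sense: 1. The left singular vectors of $\mathsf{G}$ provide one set of optimal observations for (B): $\hat{\mathsf{M}}=\hat{\mathsf{U}}_n=[\hat{\mathsf{u}}_1,\dots,\hat{\mathsf{u}}_n]$ solves (B). In this setting (that is, with $\mathsf{M}=\hat{\mathsf{U}}_n$),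 for $\mathsf{u}=\mathsf{G}\mathsf{f}$, the columns $\mathsf{w}_i$ of $\mathsf{W}=\mathsf{K}^\top\mathsf{\Theta}^{-1}$ and the components $\Psi_i$ of $\mathsf{\Psi}=\mathsf{M}^\top\mathsf{u}$ satisfy $$\mathsf{w}_i=\hat{\mathsf{u}}_i,\qquad \Psi_i=\hat\lambda_i\langle\mathsf{f},\hat{\mathsf{v}}_i\rangle,\qquad i=1,\dots,n.$$ 2. The optimal observation provides the left singular vectors of $\mathsf{G}$: for any solution $\hat{\mathsf{M}}$ of (B), $$\mathrm{Span}(\hat{\mathsf{U}}_n)=\mathrm{Span}(\hat{\mathsf{M}}),$$ where $\mathrm{Span}$ denotes the column space.
   Context: Here the weight matrices are identities ($\mathsf{\Pi}_{\mathsf{X}}=\mathsf{\Pi}_{\mathsf{Y}}=\mathsf{I}_N$), so all inner products $\langle\cdot,\cdot\rangle$ and norms $\|\cdot\|_2$ on $\mathbb{R}^N$ are Euclidean. The SVD of $\mathsf{G}$ is $\mathsf{G}\hat{\mathsf{V}}=\hat{\mathsf{U}}\hat{\mathsf{\Lambda}}$, $\mathsf{G}^\top\hat{\mathsf{U}}=\hat{\mathsf{V}}\hat{\mathsf{\Lambda}}$, with orthogonal $\hat{\mathsf{U}}=[\hat{\mathsf{u}}_1,\dots,\hat{\mathsf{u}}_N]$, $\hat{\mathsf{V}}=[\hat{\mathsf{v}}_1,\dots,\hat{\mathsf{v}}_N]$ and $\hat{\mathsf{\Lambda}}=\mathrm{diag}(\hat\lambda_1,\dots,\hat\lambda_N)$;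 the singular values are assumed distinct, $\hat\lambda_1>\hat\lambda_2>\cdots>\hat\lambda_N>0$. Bayesian setting: consider $\mathsf{L}\mathsf{u}=\mathsf{f}$, where $\mathsf{f}$ has a prior with i.i.d. standard Gaussian components, so $\mathsf{u}=\mathsf{G}\mathsf{f}$ is Gaussian with covariance $\mathsf{C}=\mathsf{G}\mathsf{G}^\top$. For an observation matrix $\mathsf{M}=[\mathsf{m}_1,\dots,\mathsf{m}_n]\in\mathbb{R}^{N\times n}$ of rank $n$, the observed data are $\mathsf{\Psi}=\mathsf{M}^\top\mathsf{u}=(\Psi_1,\dots,\Psi_n)^\top$. Define $\mathsf{K}=\mathsf{M}^\top\mathsf{C}\in\mathbb{R}^{n\times N}$, $\mathsf{\Theta}=\mathsf{M}^\top\mathsf{C}\mathsf{M}\in\mathbb{R}^{n\times n}$ and $\mathsf{W}=\mathsf{K}^\top\mathsf{\Theta}^{-1}=[\mathsf{w}_1,\dots,\mathsf{w}_n]\in\mathbb{R}^{N\times n}$. The distribution of $\mathsf{u}$ conditioned on noiseless observation of $\mathsf{\Psi}$ has mean $\mathsf{W}\mathsf{\Psi}$ and covariance $\mathsf{C}-\mathsf{K}^\top\mathsf{\Theta}^{-1}\mathsf{K}$. *)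

(* Defs.v *)
From mathcomp Require Import all_boot all_order all_algebra.
From mathcomp Require Import reals.

Set Implicit Arguments.
Unset Strict Implicit.
Unset Printing Implicit Defensive.

Import Order.TTheory GRing.Theory Num.Theory.
Local Open Scope ring_scope.

Section Optimization.
Variables (R : realType) (T : Type).

Definition is_argmin (A : T -> Prop) (F : T -> R) (x : T) : Prop :=
  A x /\ forall y, A y -> F x <= F y.

Definition is_argmax (A : T -> Prop) (F : T -> R) (x : T) : Prop :=
  A x /\ forall y, A y -> F y <= F x.

(* Attained extrema, as opposed to infima and suprema. *)
Definition is_min (A : T -> Prop) (F : T -> R) (m : R) : Prop :=
  exists2 x, is_argmin A F x & F x = m.

Definition is_max (A : T -> Prop) (F : T -> R) (m : R) : Prop :=
  exists2 x, is_argmax A F x & F x = m.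

End Optimization.

Section Euclidean.
Variables (R : realType) (N : nat).

Definition dotv (x y : 'cV[R]_N) : R := \sum_(i < N) x i 0 * y i 0.

(* The norm that mathcomp-analysis puts on matrices is the maximum norm,
   hence this separate definition. *)
Definition norm2 (x : 'cV[R]_N) : R := Num.sqrt (dotv x x).

Definition orthogonal_mx (Q : 'M[R]_N) : Prop := Q^T *m Q = 1%:M.

(* Singular value decomposition with distinct positive singular values in
   decreasing order; the singular vectors are the columns of U and V. *)
Definition is_distinct_svd (G U V : 'M[R]_N) (lam : 'rV[R]_N) : Prop :=
  [/\ orthogonal_mx U, orthogonal_mx V,
      G *m V = U *m diag_mx lam & G^T *m U = V *m diag_mx lam] /\
  [/\ forall i j : 'I_N, (i < j)%N -> lam 0 j < lam 0 i
    & forall i : 'I_N, 0 < lam 0 i].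

End Euclidean.

Definition first_cols (R : realType) (N n : nat) (hn : (n <= N)%N)
    (U : 'M[R]_N) : 'M[R]_(N, n) :=
  colsub (widen_ord hn) U.

(* kappa = min_Vn max_(f != 0) min_c |G f - G Vn c| / |f|, every extremum being
   attained: d Vn f is the value of the minimum over c, and e Vn that of the
   maximum over f. *)
Definition is_kolmogorov_width (R : realType) (N n : nat) (G : 'M[R]_N)
    (kappa : R) : Prop :=
  exists (d : 'M[R]_(N, n) -> 'cV[R]_N -> R) (e : 'M[R]_(N, n) -> R),
  [/\ forall Vn f, f != 0 ->
        is_min (fun _ : 'cV[R]_n => True)
               (fun c => norm2 (G *m f - G *m Vn *m c) / norm2 f) (d Vn f),
      forall Vn, is_max (fun f => f != 0) (d Vn) (e Vn)
    & is_min (fun _ => True) e kappa].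

Section Bayes.
Variables (R : realType) (N n : nat) (G : 'M[R]_N).

(* Covariance of u = G f when f has i.i.d. standard Gaussian components. *)
Definition covC : 'M[R]_N := G *m G^T.

Variable M : 'M[R]_(N, n).

Definition obsK : 'M[R]_(n, N) := M^T *m covC.

Definition obsTheta : 'M[R]_n := M^T *m covC *m M.

Definition obsW : 'M[R]_(N, n) := obsK^T *m invmx obsTheta.

Definition observe (u : 'cV[R]_N) : 'cV[R]_n := M^T *m u.

(* Total variance of u conditioned on the noiseless observation M^T u. *)
Definition posterior_variance : R :=
  \tr (covC - obsK^T *m invmx obsTheta *m obsK).

Definition explained_variance : R :=
  \tr (obsK^T *m invmx obsTheta *m obsK).

End Bayes.

Definition solves_B (R : realType) (N n : nat) (G : 'M[R]_N)
    (M : 'M[R]_(N, n)) : Prop :=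
  is_argmin (fun M' : 'M[R]_(N, n) => \rank M' = n) (posterior_variance G) M.

Definition solves_B_max (R : realType) (N n : nat) (G : 'M[R]_N)
    (M : 'M[R]_(N, n)) : Prop :=
  is_argmax (fun M' : 'M[R]_(N, n) => \rank M' = n) (explained_variance G) M.

(* Equality of column spaces; the scope MS compares row spaces. *)
Definition same_colspan (R : realType) (N p q : nat) (A : 'M[R]_(N, p))
    (B : 'M[R]_(N, q)) : Prop :=
  (A^T == B^T)%MS.

(* Main.v *)
Require Import Defs.
From mathcomp Require Import all_boot all_order all_algebra.
From mathcomp Require Import reals boolp classical_sets topology normedtype derive.

Set Implicit Arguments.
Unset Strict Implicit.
Unset Printing Implicit Defensive.

Import Order.TTheory GRing.Theory Num.Theory numFieldNormedType.Exports.
Local Open Scope ring_scope.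

(** The n-width and the variance problem have the same solution because both
are governed by the leading left singular vectors of G; write Lam for the
diagonal matrix of singular values.

For the n-width, fixing Vn turns the inner minimum into a least-squares
problem, solved by a linear map f |-> S (G f), since the normal equations of a
Gram matrix are always solvable ([sub_gram], [least_squares]).  The middle
problem then asks for the largest stretching factor of a matrix, attained by
compactness of the sphere ([max_norm_ratio]).  The outer minimum is the
(n+1)-st singular value, or 0 if n = N.  It is a lower bound because among the
combinations of the first n+1 right singular vectors some nonzero f has G f
orthogonal to the n columns of G Vn ([singular_lower]); it is reached by the
first n right singular vectors ([leading_singular_upper]).

For the variance problem, the trace of C does not depend on M, so minimizing
the posterior variance amounts to maximizing the explained one.  In the
singular bases M becomes Q = Lam U^T M and the explained variance becomes the
weighted sum of the lam_i^2 P_ii, where P is the orthogonal projector onto the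
column space of Q ([explained_varianceE]).  The diagonal of a rank-n projector
lies in [0, 1] and sums to n, so the weighted sum is largest when all the mass
sits on the n largest weights.  As the weights are strictly decreasing,
equality forces P_ii = 0 for every i >= n ([explained_variance_gap]).  A zero
diagonal entry of a projector kills the whole row, hence the rows of U^T M
beyond the first n vanish: M lies in the span of the leading left singular
vectors, and equal ranks give equal spans ([leading_same_colspan]). *)

(** * Euclidean inner product and norm *)

Lemma dotvE (R : realType) (N : nat) (x y : 'cV[R]_N) :
  dotv x y = (x^T *m y) 0 0.
Proof. by rewrite mxE; apply: eq_bigr => i _; rewrite mxE. Qed.

Lemma dotv_ge0 (R : realType) (N : nat) (x : 'cV[R]_N) : 0 <= dotv x x.
Proof. by apply: sumr_ge0 => i _; rewrite -expr2 sqr_ge0. Qed.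

Lemma dotv_eq0 (R : realType) (N : nat) (x : 'cV[R]_N) :
  (dotv x x == 0) = (x == 0).
Proof.
apply/idP/eqP => [|->]; last first.
  by rewrite /dotv big1 // => i _; rewrite mxE mul0r.
rewrite psumr_eq0 => [/allP x0|i _]; last by rewrite -expr2 sqr_ge0.
apply/colP => i; rewrite mxE; apply/eqP.
by have := x0 i (mem_index_enum i); rewrite /= -expr2 sqrf_eq0.
Qed.

Lemma dotvZ (R : realType) (N : nat) (a : R) (x : 'cV[R]_N) :
  dotv (a *: x) (a *: x) = a ^+ 2 * dotv x x.
Proof.
by rewrite /dotv mulr_sumr; apply: eq_bigr => i _; rewrite !mxE expr2 mulrACA.
Qed.

Lemma dotv_pythagoras (R : realType) (N : nat) (x y : 'cV[R]_N) :
  dotv x y = 0 -> dotv (x + y) (x + y) = dotv x x + dotv y y.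
Proof.
move=> xy0; rewrite -[RHS]addr0 -[in RHS](mul0rn _ 2) -[in RHS]xy0.
rewrite /dotv -sumrMnl -!big_split /=; apply: eq_bigr => i _.
by rewrite !mxE -!expr2 sqrrD addrAC.
Qed.

Lemma dotv_range_eq0 (R : realType) (N n : nat) (A : 'M[R]_(N, n))
    (x : 'cV[R]_N) (y : 'cV[R]_n) :
  A^T *m x = 0 -> dotv x (A *m y) = 0.
Proof.
move=> Ax0; rewrite dotvE mulmxA -[x^T *m A]trmxK trmx_mul trmxK Ax0 trmx0.
by rewrite mul0mx mxE.
Qed.

Lemma dotv_orthogonal (R : realType) (N n : nat) (Q : 'M[R]_(N, n))
    (x : 'cV[R]_n) :
  Q^T *m Q = 1%:M -> dotv (Q *m x) (Q *m x) = dotv x x.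
Proof. by move=> hQ; rewrite !dotvE trmx_mul mulmxA -(mulmxA _ Q^T) hQ mulmx1. Qed.

Lemma norm2_ge0 (R : realType) (N : nat) (x : 'cV[R]_N) : 0 <= norm2 x.
Proof. exact: sqrtr_ge0. Qed.

Lemma norm2_gt0 (R : realType) (N : nat) (x : 'cV[R]_N) :
  (0 < norm2 x) = (x != 0).
Proof. by rewrite sqrtr_gt0 lt_def dotv_eq0 dotv_ge0 andbT. Qed.

Lemma ler_norm2 (R : realType) (N P : nat) (x : 'cV[R]_N) (y : 'cV[R]_P) :
  (norm2 x <= norm2 y) = (dotv x x <= dotv y y).
Proof. by rewrite ler_sqrt ?dotv_ge0. Qed.

Lemma norm2Z (R : realType) (N : nat) (a : R) (x : 'cV[R]_N) :
  norm2 (a *: x) = `|a| * norm2 x.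
Proof. by rewrite /norm2 dotvZ sqrtrM ?sqr_ge0 // sqrtr_sqr. Qed.

Lemma norm2_le_scale (R : realType) (N P : nat) (k : R) (x : 'cV[R]_N)
    (y : 'cV[R]_P) :
  0 <= k -> (norm2 x <= k * norm2 y) = (dotv x x <= k ^+ 2 * dotv y y).
Proof. by move=> k0; rewrite -{1}(ger0_norm k0) -norm2Z ler_norm2 dotvZ. Qed.

Lemma norm2_ge_scale (R : realType) (N P : nat) (k : R) (x : 'cV[R]_N)
    (y : 'cV[R]_P) :
  0 <= k -> (k * norm2 y <= norm2 x) = (k ^+ 2 * dotv y y <= dotv x x).
Proof. by move=> k0; rewrite -{1}(ger0_norm k0) -norm2Z ler_norm2 dotvZ. Qed.

(** * Gram matrices and least squares *)

(** Each column x of [B] satisfies |A x|^2 = x^T A^T A x = 0. *)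
Lemma gram_mulmx_eq0 (R : realType) (N n p : nat) (A : 'M[R]_(N, n))
    (B : 'M[R]_(n, p)) :
  A^T *m A *m B = 0 -> A *m B = 0.
Proof.
move=> h; apply/matrixP => i j; rewrite mxE.
have : dotv (col j (A *m B)) (col j (A *m B)) = 0.
  have -> : dotv (col j (A *m B)) (col j (A *m B)) = ((A *m B)^T *m (A *m B)) j j.
    by rewrite [RHS]mxE; apply: eq_bigr => k _; rewrite !mxE.
  by rewrite trmx_mul -mulmxA [A^T *m _]mulmxA h mulmx0 mxE.
move/eqP; rewrite dotv_eq0 => /eqP/colP/(_ i).
by rewrite !mxE.
Qed.

(** The cokernel of [A^T *m A] is annihilated by [A].  In transposed form this
says that the normal equations A^T A x = A^T b are solvable for every b, even
when [A] is rank deficient. *)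
Lemma sub_gram (R : realType) (N n : nat) (A : 'M[R]_(N, n)) :
  (A <= A^T *m A)%MS.
Proof. by rewrite submxE; apply/eqP/gram_mulmx_eq0; exact: mulmx_coker. Qed.

Lemma gram_unitmx (R : realType) (N n : nat) (A : 'M[R]_(N, n)) :
  \rank A = n -> A^T *m A \in unitmx.
Proof.
move=> rA; rewrite -row_free_unit -row_leq_rank -{1}rA.
exact/mxrankS/sub_gram.
Qed.

(** The minimizer is chosen linear in the right-hand side [b], so that the
residual is again a matrix applied to the data.  [S] is any solution of
A^T A S = A^T, which makes residuals orthogonal to the range of [A]. *)
Lemma least_squares (R : realType) (N n : nat) (A : 'M[R]_(N, n)) :
  exists S : 'M[R]_(n, N), forall (b : 'cV[R]_N) c,
    norm2 (b - A *m (S *m b)) <= norm2 (b - A *m c).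
Proof.
have [X hX] := submxP (sub_gram A).
exists X^T => b c; rewrite ler_norm2.
have normal_eq : A^T *m A *m X^T = A^T.
  by rewrite {3}hX !trmx_mul trmxK.
set r := b - _.
have rA0 : A^T *m r = 0 by rewrite mulmxBr !mulmxA normal_eq subrr.
have -> : b - A *m c = r + A *m (X^T *m b - c).
  by rewrite mulmxBr addrA subrK.
by rewrite dotv_pythagoras ?lerDl ?dotv_ge0 ?dotv_range_eq0.
Qed.

(** * Existence of the Kolmogorov width *)

Lemma const_mx1_neq0 (R : realType) (N : nat) :
  (0 < N)%N -> (const_mx 1 : 'cV[R]_N) != 0.
Proof.
move=> hN; apply/eqP => /colP/(_ (Ordinal hN))/eqP.
by rewrite !mxE oner_eq0.
Qed.

(** By homogeneity the ratio is determined by its values on the unit sphere,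
where the continuous quadratic form |T f|^2 attains a maximum. *)
Lemma max_norm_ratio (R : realType) (N p : nat) (T : 'M[R]_(p, N)) :
  (0 < N)%N ->
  exists f0 : 'cV[R]_N, f0 != 0 /\ forall f, f != 0 ->
    norm2 (T *m f) / norm2 f <= norm2 (T *m f0) / norm2 f0.
Proof.
move=> hN.
have cquad q (B : 'M[R]_(q, N)) :
    continuous (fun v : 'rV[R]_N => dotv (B *m v^T) (B *m v^T)).
  apply: (continuous_big (@add_continuous _)) => i _.
  have clin : continuous (fun v : 'rV[R]_N => (B *m v^T) i 0).
    under eq_fun do rewrite mxE.
    apply: (continuous_big (@add_continuous _)) => j _ v.
    under eq_fun do rewrite [_^T _ _]mxE.
    apply: (@continuousM _ _ (fun=> B i j) (fun v : 'rV[R]_N => v 0 j)).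
      exact: cst_continuous.
    exact: coord_continuous.
  by move=> v; apply: continuousM; exact: clin.
(* The identity factor lets [cquad] apply to the norm itself. *)
pose S := [set v : 'rV[R]_N | dotv (1%:M *m v^T) (1%:M *m v^T) = 1]%classic.
have normS (v : 'cV[R]_N) : v != 0 -> S ((norm2 v)^-1 *: v)^T.
  move=> v0; rewrite /S /= trmxK mul1mx dotvZ exprVn sqr_sqrtr ?dotv_ge0 //.
  by rewrite mulVf // dotv_eq0.
have cptS : compact S.
  apply: bounded_closed_compact; last first.
    apply: (@preimage_closed _ _
      (fun v : 'rV[R]_N => dotv (1%:M *m v^T) (1%:M *m v^T))
      [set x | x = 1]%classic);
      last exact: closed_eq.
    by move=> v _; exact: cquad.
  exists 1; split => // x x1 v Sv.
  apply: le_trans (ltW x1); rewrite [leLHS]/Num.norm /= mx_normrE.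
  apply: bigmax_le => // -[i j] _ /=; rewrite (ord1 i).
  rewrite -(ler_pXn2r (ltn0Sn 1)) ?nnegrE // real_normK ?num_real // expr1n.
  rewrite -Sv mul1mx /dotv (bigD1 j) //= !mxE -expr2 lerDl.
  by apply: sumr_ge0 => k _; rewrite -expr2 sqr_ge0.
have [c cS cmax] := @EVT_max_rV R N _ S
   (ex_intro _ _ (normS _ (const_mx1_neq0 R hN))) cptS
   (continuous_subspaceT (cquad _ T)).
move: cS; rewrite inE /S /= mul1mx => c1.
have c0 : c^T != 0 by rewrite -dotv_eq0 c1 oner_eq0.
exists c^T; split=> // f f0; rewrite /(norm2 c^T) c1 sqrtr1 divr1.
have := cmax _ (mem_set (normS f f0)); rewrite trmxK => le_c.
rewrite mulrC -[(norm2 f)^-1]ger0_norm ?invr_ge0 ?norm2_ge0 // -norm2Z.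
by rewrite scalemxAr ler_norm2.
Qed.

(** Both inner extrema are attained for every [Vn], so the outer minimum only
needs a value [k] bounding each inner maximum below and a [V0] bounding it
above by the same [k]. *)
Lemma kolmogorov_width_intro (R : realType) (N n : nat) (G : 'M[R]_N) (k : R)
    (V0 : 'M[R]_(N, n)) :
  (0 < N)%N ->
  (forall Vn : 'M[R]_(N, n), exists2 f : 'cV[R]_N, f != 0 &
     forall c, k * norm2 f <= norm2 (G *m f - G *m Vn *m c)) ->
  (forall f, exists c, norm2 (G *m f - G *m V0 *m c) <= k * norm2 f) ->
  is_kolmogorov_width n G k.
Proof.
move=> hN lower upper.
have [S hS] := choice (fun Vn : 'M[R]_(N, n) => least_squares (G *m Vn)).
pose T Vn := G - G *m Vn *m (S Vn *m G).
have TE Vn f : T Vn *m f = G *m f - G *m Vn *m (S Vn *m (G *m f)).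
  by rewrite mulmxBl !mulmxA.
pose d Vn f := norm2 (T Vn *m f) / norm2 f.
have [F0 hF0] := choice (fun Vn => max_norm_ratio (T Vn) hN).
have dmin Vn f c : f != 0 -> d Vn f <= norm2 (G *m f - G *m Vn *m c) / norm2 f.
  by move=> f0; rewrite ler_pM2r ?invr_gt0 ?norm2_gt0 // TE.
have d_ge_k Vn : k <= d Vn (F0 Vn).
  have [f f0 hf] := lower Vn; have [_ /(_ f f0)] := hF0 Vn.
  by apply: le_trans; rewrite ler_pdivlMr ?norm2_gt0 // TE.
have d_le_k f : f != 0 -> d V0 f <= k.
  move=> f0; have [c hc] := upper f; apply: le_trans (dmin V0 f c f0) _.
  by rewrite ler_pdivrMr ?norm2_gt0.
exists d, (fun Vn => d Vn (F0 Vn)); split.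
- move=> Vn f f0; exists (S Vn *m (G *m f)); last by rewrite /d TE.
  by split=> // c _; rewrite -TE; exact: dmin.
- by move=> Vn; exists (F0 Vn) => //; have [] := hF0 Vn.
- have dV0 : d V0 (F0 V0) = k.
    by apply/le_anti; rewrite d_ge_k d_le_k //; have [] := hF0 V0.
  by exists V0 => //; split => // Vn _; rewrite dV0.
Qed.

(** * Kolmogorov width from the singular values *)

Lemma strictly_decreasing_noninc (R : realType) (N : nat) (w : 'I_N -> R) :
  (forall i j : 'I_N, (i < j)%N -> w j < w i) ->
  forall i j : 'I_N, (i <= j)%N -> w j <= w i.
Proof.
move=> w_decr i j; rewrite leq_eqVlt => /orP[/eqP/val_inj -> //|].
by move=> /w_decr/ltW.
Qed.

Lemma first_colsM (R : realType) (N n : nat) (hn : (n <= N)%N)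
    (A B : 'M[R]_N) :
  A *m first_cols hn B = first_cols hn (A *m B).
Proof.
by apply/matrixP => i j; rewrite !mxE; apply: eq_bigr => k _; rewrite mxE.
Qed.

Lemma first_cols_diag (R : realType) (N n : nat) (hn : (n <= N)%N)
    (A : 'M[R]_N) (d : 'rV[R]_N) :
  first_cols hn (A *m diag_mx d) =
  first_cols hn A *m diag_mx (\row_i d 0 (widen_ord hn i)).
Proof. by apply/matrixP => i j; rewrite !mul_mx_diag !mxE. Qed.

Lemma first_cols_orthonormal (R : realType) (N n : nat) (hn : (n <= N)%N)
    (Q : 'M[R]_N) :
  orthogonal_mx Q -> (first_cols hn Q)^T *m first_cols hn Q = 1%:M.
Proof.
move=> hQ; apply/matrixP => i j.
have /matrixP/(_ (widen_ord hn i) (widen_ord hn j)) := hQ.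
rewrite !mxE => h; rewrite -[RHS]/((widen_ord hn i == widen_ord hn j)%:R).
by rewrite -h; apply: eq_bigr => k _; rewrite !mxE.
Qed.

Lemma orthogonal_mxC (R : realType) (N : nat) (Q : 'M[R]_N) :
  orthogonal_mx Q -> Q *m Q^T = 1%:M.
Proof. exact: mulmx1C. Qed.

Lemma dotv_diag (R : realType) (N : nat) (d : 'rV[R]_N) (x : 'cV[R]_N) :
  dotv (diag_mx d *m x) (diag_mx d *m x) = \sum_i d 0 i ^+ 2 * x i 0 ^+ 2.
Proof.
by apply: eq_bigr => i _; rewrite mul_diag_mx mxE -expr2 exprMn.
Qed.

(** In the basis [V], projecting onto the first [n] columns keeps the first [n]
coordinates and erases the others. *)
Lemma first_cols_residual (R : realType) (N n : nat) (hn : (n <= N)%N)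
    (V : 'M[R]_N) (f : 'cV[R]_N) (i : 'I_N) :
  orthogonal_mx V ->
  (V^T *m (f - first_cols hn V *m ((first_cols hn V)^T *m f))) i 0 =
  if (i < n)%N then 0 else (V^T *m f) i 0.
Proof.
move=> hV; rewrite mulmxBr [V^T *m (_ *m _)]mulmxA first_colsM hV.
set a := V^T *m f.
suff -> : first_cols hn 1%:M *m ((first_cols hn V)^T *m f) =
    \col_i (if (i < n)%N then a i 0 else 0).
  by rewrite !mxE; case: ifP => _; rewrite ?subrr ?subr0.
apply/matrixP => k l; rewrite (ord1 l) {i l} [RHS]mxE [LHS]mxE.
transitivity (\sum_(j < n | widen_ord hn j == k) a k 0).
  rewrite [RHS]big_mkcond /=; apply: eq_bigr => j _; rewrite !mxE eq_sym.
  case: eqP => [<-|_]; last by rewrite mul0r.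
  by rewrite mul1r; apply: eq_bigr => l _; rewrite !mxE.
case: ltnP => [lt_kn|le_nk].
  by rewrite (big_pred1 (Ordinal lt_kn)) // => j; rewrite -!val_eqE.
rewrite big_pred0 // => j.
by apply/negbTE; rewrite -val_eqE /= neq_ltn (leq_trans (ltn_ord j) le_nk).
Qed.

(** Taking for [c] the first [n] coordinates of [f] leaves only the
coordinates i >= n, which [G] stretches by at most [k]. *)
Lemma leading_singular_upper (R : realType) (N n : nat) (hn : (n <= N)%N)
    (G U V : 'M[R]_N) (lam : 'rV[R]_N) (k : R) (f : 'cV[R]_N) :
  is_distinct_svd G U V lam -> 0 <= k ->
  (forall i : 'I_N, (n <= i)%N -> lam 0 i <= k) ->
  exists c, norm2 (G *m f - G *m first_cols hn V *m c) <= k * norm2 f.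
Proof.
move=> [[hU hV hGV _] [_ lam0]] k0 tail_le; exists ((first_cols hn V)^T *m f).
rewrite norm2_le_scale // -[in leRHS](mul1mx f) -(orthogonal_mxC hV) -!mulmxA.
rewrite (dotv_orthogonal _ hV) -mulmxBr.
set g := f - _; have -> : G *m g = U *m (diag_mx lam *m (V^T *m g)).
  by rewrite [RHS]mulmxA -hGV -!mulmxA [V *m _]mulmxA (orthogonal_mxC hV) mul1mx.
rewrite (dotv_orthogonal _ hU) dotv_diag /dotv mulr_sumr; apply: ler_sum => i _.
rewrite (first_cols_residual hn f i hV) -expr2; case: ltnP => [_|le_ni].
  by rewrite expr0n mulr0 mulr_ge0 ?sqr_ge0.
rewrite ler_wpM2r ?sqr_ge0 // ler_pXn2r ?nnegrE ?tail_le //.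
exact/ltW.
Qed.

Lemma exists_kernel_vector (R : realType) (m n : nat) (B : 'M[R]_(m, n)) :
  (m < n)%N -> exists2 a : 'cV[R]_n, a != 0 & B *m a = 0.
Proof.
move=> lt_mn; have ker_neq0 : kermx B^T != 0.
  rewrite -mxrank_eq0 mxrank_ker -lt0n subn_gt0.
  by rewrite mxrank_tr (leq_ltn_trans (rank_leq_row B)).
exists (nz_row (kermx B^T))^T.
  by rewrite -(inj_eq (@trmx_inj _ _ _)) trmxK trmx0 nz_row_eq0.
apply: (@trmx_inj _ _ _); rewrite trmx_mul trmxK trmx0.
exact/sub_kermxP/nz_row_sub.
Qed.

(** The [n.+1] leading right singular vectors span a space too large to be
met by [n] orthogonality conditions: it contains a nonzero [f] with [G *m f]
orthogonal to the range of [G *m Vn].  No [c] can then reduce |G f|, and [G]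
stretches that space by at least its smallest singular value there. *)
Lemma singular_lower (R : realType) (N n : nat) (lt_nN : (n < N)%N)
    (G U V : 'M[R]_N) (lam : 'rV[R]_N) (Vn : 'M[R]_(N, n)) :
  is_distinct_svd G U V lam ->
  exists2 f, f != 0 & forall c,
    lam 0 (Ordinal lt_nN) * norm2 f <= norm2 (G *m f - G *m Vn *m c).
Proof.
move=> [[hU hV hGV _] [lam_decr lam0]]; set k := lam 0 _.
pose V1 := first_cols lt_nN V.
have [a a0 ha] := exists_kernel_vector ((G *m Vn)^T *m (G *m V1)) (ltnSn n).
have V1V1 : V1^T *m V1 = 1%:M by exact: first_cols_orthonormal.
exists (V1 *m a) => [|c].
  by apply: contra_neq a0 => h; rewrite -[a]mul1mx -V1V1 -mulmxA h mulmx0.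
rewrite norm2_ge_scale; last exact/ltW/lam0.
rewrite (dotv_orthogonal _ V1V1).
rewrite -[- _]mulmxN dotv_pythagoras; last first.
  by apply: dotv_range_eq0; rewrite -ha !mulmxA.
apply: ler_wpDr; first exact: dotv_ge0.
rewrite mulmxA first_colsM hGV first_cols_diag -mulmxA.
rewrite (dotv_orthogonal _ (first_cols_orthonormal lt_nN hU)) dotv_diag.
rewrite /dotv mulr_sumr; apply: ler_sum => i _.
rewrite -expr2 ler_wpM2r ?sqr_ge0 // mxE.
rewrite ler_pXn2r ?nnegrE ?(ltW (lam0 _)) //.
by apply: (@strictly_decreasing_noninc _ _ (lam 0) lam_decr); rewrite /= -ltnS.
Qed.

Lemma kolmogorov_width_svd (R : realType) (N n : nat) (hN : (0 < N)%N)
    (hn : (n <= N)%N) (G U V : 'M[R]_N) (lam : 'rV[R]_N) :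
  is_distinct_svd G U V lam -> exists k, is_kolmogorov_width n G k.
Proof.
move=> hsvd; have [_ [lam_decr lam0]] := hsvd.
have [lt_nN|le_Nn] := ltnP n N.
  exists (lam 0 (Ordinal lt_nN)).
  apply: (kolmogorov_width_intro (V0 := first_cols hn V)) => // [Vn|f].
    exact: singular_lower hsvd.
  apply: leading_singular_upper hsvd _ _; first exact/ltW.
  by move=> i n_i; exact: (@strictly_decreasing_noninc _ _ (lam 0) lam_decr).
exists 0; apply: (kolmogorov_width_intro (V0 := first_cols hn V)) => // [Vn|f].
  by exists (const_mx 1) => [|c]; rewrite ?const_mx1_neq0 ?mul0r ?norm2_ge0.
apply: leading_singular_upper hsvd _ _ => // i le_ni.
by have := leq_trans (ltn_ord i) (leq_trans le_Nn le_ni); rewrite ltnn.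
Qed.

(** * Orthogonal projectors *)

(** The projector onto the column space of [Q] when [Q] has full column rank.
Explained variances are written in this shape, with the inverse of a Gram
matrix in the middle. *)
Definition orthoproj (R : realType) (N n : nat) (Q : 'M[R]_(N, n)) : 'M[R]_N :=
  Q *m invmx (Q^T *m Q) *m Q^T.

Lemma tr_orthoproj (R : realType) (N n : nat) (Q : 'M[R]_(N, n)) :
  (orthoproj Q)^T = orthoproj Q.
Proof. by rewrite /orthoproj !trmx_mul !trmxK trmx_inv trmx_mul trmxK mulmxA. Qed.

Lemma orthoproj_range (R : realType) (N n : nat) (Q : 'M[R]_(N, n)) :
  \rank Q = n -> orthoproj Q *m Q = Q.
Proof. by move=> /gram_unitmx uQ; rewrite /orthoproj -mulmxA mulmxKV. Qed.

Lemma mxtrace_orthoproj (R : realType) (N n : nat) (Q : 'M[R]_(N, n)) :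
  \rank Q = n -> \tr (orthoproj Q) = n%:R.
Proof.
by move=> /gram_unitmx uQ; rewrite mxtrace_mulC mulmxA mulmxV // mxtrace1.
Qed.

(** A symmetric idempotent P satisfies P = P P^T; the bounds on its diagonal
follow from this sum of squares. *)
Lemma orthoproj_diag (R : realType) (N n : nat) (Q : 'M[R]_(N, n)) (i : 'I_N) :
  \rank Q = n -> orthoproj Q i i = \sum_j orthoproj Q i j ^+ 2.
Proof.
move=> rQ; have -> : orthoproj Q i i = (orthoproj Q *m orthoproj Q) i i.
  by rewrite {2}/orthoproj !mulmxA orthoproj_range.
rewrite mxE; apply: eq_bigr => j _.
by rewrite expr2; congr (_ * _); rewrite -[in RHS]tr_orthoproj [RHS]mxE.
Qed.

Lemma orthoproj_diag_ge0 (R : realType) (N n : nat) (Q : 'M[R]_(N, n))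
    (i : 'I_N) :
  \rank Q = n -> 0 <= orthoproj Q i i.
Proof.
by move=> rQ; rewrite orthoproj_diag //; apply: sumr_ge0 => j _; rewrite sqr_ge0.
Qed.

(** One term of the sum of squares is p^2, so p^2 <= p. *)
Lemma orthoproj_diag_le1 (R : realType) (N n : nat) (Q : 'M[R]_(N, n))
    (i : 'I_N) :
  \rank Q = n -> orthoproj Q i i <= 1.
Proof.
move=> rQ; set p := orthoproj Q i i.
have p2_le : p ^+ 2 <= p.
  rewrite {2}/p orthoproj_diag // (bigD1 i) //= lerDl.
  by apply: sumr_ge0 => j _; rewrite sqr_ge0.
rewrite leNgt; apply/negP => p_gt1; move: p2_le.
by rewrite expr2 ger_pMr ?(lt_trans ltr01) // leNgt p_gt1.
Qed.

(** The whole row [i] of the projector P vanishes, hence so does that of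
Q = P Q. *)
Lemma orthoproj_diag_eq0 (R : realType) (N n : nat) (Q : 'M[R]_(N, n))
    (i : 'I_N) (j : 'I_n) :
  \rank Q = n -> orthoproj Q i i = 0 -> Q i j = 0.
Proof.
move=> rQ /eqP; rewrite orthoproj_diag // psumr_eq0 => [/allP h|k _]; last first.
  exact: sqr_ge0.
rewrite -[Q in LHS](orthoproj_range rQ) mxE big1 // => k _.
by have := h k (mem_index_enum k); rewrite /= sqrf_eq0 => /eqP ->; rewrite mul0r.
Qed.

(** * Concentrating mass on the largest weights *)

Lemma sum_first (R : realType) (N n : nat) (hn : (n <= N)%N) (F : 'I_N -> R) :
  \sum_(i < n) F (widen_ord hn i) = \sum_(i < N) F i * (i < n)%:R.
Proof.
rewrite -(big_ord_narrow_cond (P := predT)) /= big_mkcond /=.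
by apply: eq_bigr => i _; case: ifP; rewrite ?mulr1 ?mulr0.
Qed.

(** The indicator of i < n and [p] have the same total mass, so shifting all
the weights by a constant [t] does not change the difference of the weighted
sums.  With [t] separating the first [n] weights from the others, every term
on the right is nonnegative: the maximality of the leading weights and its
equality case are read off term by term. *)
Lemma threshold_gap (R : realType) (N n : nat) (hn : (n <= N)%N)
    (w p : 'I_N -> R) (t : R) :
  \sum_i p i = n%:R ->
  \sum_(i < n) w (widen_ord hn i) - \sum_i w i * p i =
  \sum_i (w i - t) * ((i < n)%:R - p i).
Proof.
move=> sum_p; have sum_gap : \sum_(i < N) ((i < n)%:R - p i) = 0.
  rewrite sumrB sum_p; apply/eqP; rewrite subr_eq0; apply/eqP.
  have /= := sum_first hn (fun=> 1 : R); rewrite sumr_const card_ord => ->.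
  by apply: eq_bigr => i _; rewrite mul1r.
under [RHS]eq_bigr do rewrite mulrBl.
rewrite sumrB -mulr_sumr sum_gap mulr0 subr0 sum_first -sumrB.
by apply: eq_bigr => i _; rewrite mulrBr.
Qed.

Lemma threshold_terms_ge0 (R : realType) (N n : nat)
    (w p : 'I_N -> R) (t : R) :
  (forall i : 'I_N, (i < n)%N -> t <= w i) ->
  (forall i : 'I_N, (n <= i)%N -> w i < t) ->
  (forall i, 0 <= p i <= 1) ->
  forall i : 'I_N, 0 <= (w i - t) * ((i < n)%:R - p i).
Proof.
move=> w_head w_tail p01 i; have /andP[p0 p1] := p01 i.
case: ltnP => [/w_head|/w_tail/ltW] h; first by rewrite mulr_ge0 ?subr_ge0.
by rewrite mulr_le0 ?subr_le0.
Qed.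

(** The smallest of the first [n] weights separates; for [n = 0] anything above
the largest weight does.  The inequality on the tail is strict, which is what
determines the equality case. *)
Lemma exists_threshold (R : realType) (N n : nat) (hN : (0 < N)%N)
    (hn : (n <= N)%N) (w : 'I_N -> R) :
  (forall i j : 'I_N, (i < j)%N -> w j < w i) ->
  exists t, (forall i : 'I_N, (i < n)%N -> t <= w i) /\
            (forall i : 'I_N, (n <= i)%N -> w i < t).
Proof.
move=> w_decr; have w_noninc := strictly_decreasing_noninc w_decr.
case: n hn => [|m] hm; last first.
  by exists (w (Ordinal hm)); split=> i h; [exact: w_noninc | exact: w_decr].
exists (w (Ordinal hN) + 1); split=> // i _.
by rewrite ltr_pwDr // w_noninc.
Qed.

(** * The variance problem in the singular bases *)

(** With Q = Lam U^T M one has G^T M = V Q, so that Theta is the Gram matrix of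
[Q] and K^T = U Lam Q; the orthogonal factors disappear under the trace. *)
Lemma explained_varianceE (R : realType) (N n : nat) (G U V : 'M[R]_N)
    (lam : 'rV[R]_N) (M : 'M[R]_(N, n)) :
  is_distinct_svd G U V lam ->
  explained_variance G M =
  \sum_i lam 0 i ^+ 2 * orthoproj (diag_mx lam *m U^T *m M) i i.
Proof.
move=> [[hU hV hGV hGU] _]; set Q := _ *m M.
have GtM : G^T *m M = V *m Q.
  by rewrite -[M in LHS]mul1mx -(orthogonal_mxC hU) !mulmxA hGU.
(* With [Q] opaque, [trmx_mul] does not expand its transpose. *)
clearbody Q; have GGtM : obsK G M = (U *m diag_mx lam *m Q)^T.
  rewrite /obsK /covC -hGV -[G *m V *m Q]mulmxA -GtM.
  by rewrite !trmx_mul trmxK mulmxA.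
have Theta : obsTheta G M = Q^T *m Q.
  rewrite /obsTheta /covC mulmxA -[_ *m G^T *m M]mulmxA GtM.
  rewrite -[M^T *m G]trmxK trmx_mul trmxK GtM trmx_mul -mulmxA [V^T *m _]mulmxA.
  by rewrite hV mul1mx.
rewrite /explained_variance Theta GGtM trmxK.
pose P := orthoproj Q.
transitivity (\tr (U *m (diag_mx lam *m P *m diag_mx lam *m U^T))).
  by rewrite !trmx_mul tr_diag_mx /P /orthoproj !mulmxA.
rewrite mxtrace_mulC -[_ *m U^T *m U]mulmxA hU mulmx1; apply: eq_bigr => i _.
by rewrite mul_mx_diag mxE mul_diag_mx mxE mulrAC -expr2.
Qed.

Lemma covC_svd (R : realType) (N : nat) (G U V : 'M[R]_N) (lam : 'rV[R]_N) :
  is_distinct_svd G U V lam ->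
  covC G *m U = U *m diag_mx (\row_i lam 0 i ^+ 2).
Proof.
move=> [[_ _ hGV hGU] _]; rewrite /covC -mulmxA hGU mulmxA hGV -mulmxA.
by rewrite mulmx_diag; congr (_ *m diag_mx _).
Qed.

(** The columns of [U] are eigenvectors of C with eigenvalues lam_i^2, so the
leading ones satisfy K^T = Un Theta with Theta diagonal, and then W = Un. *)
Lemma leading_obsK (R : realType) (N n : nat) (hn : (n <= N)%N)
    (G U V : 'M[R]_N) (lam : 'rV[R]_N) :
  is_distinct_svd G U V lam ->
  (obsK G (first_cols hn U))^T =
  first_cols hn U *m diag_mx (\row_i lam 0 (widen_ord hn i) ^+ 2).
Proof.
move=> hsvd; rewrite /obsK trmx_mul trmxK.
have -> : (covC G)^T = covC G by rewrite trmx_mul trmxK.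
rewrite first_colsM (covC_svd hsvd) first_cols_diag; congr (_ *m diag_mx _).
by apply/rowP => i; rewrite !mxE.
Qed.

Lemma leading_obsTheta (R : realType) (N n : nat) (hn : (n <= N)%N)
    (G U V : 'M[R]_N) (lam : 'rV[R]_N) :
  is_distinct_svd G U V lam ->
  obsTheta G (first_cols hn U) =
  diag_mx (\row_i lam 0 (widen_ord hn i) ^+ 2).
Proof.
move=> hsvd; have [[hU _ _ _] _] := hsvd.
rewrite -[LHS]trmxK trmx_mul -[(_ *m covC G)^T]/((obsK _ _)^T).
rewrite (leading_obsK hn hsvd).
by rewrite mulmxA first_cols_orthonormal // mul1mx tr_diag_mx.
Qed.

Lemma leading_obsW (R : realType) (N n : nat) (hn : (n <= N)%N)
    (G U V : 'M[R]_N) (lam : 'rV[R]_N) :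
  is_distinct_svd G U V lam -> obsW G (first_cols hn U) = first_cols hn U.
Proof.
move=> hsvd; have [_ [_ lam0]] := hsvd.
rewrite /obsW (leading_obsK hn hsvd) (leading_obsTheta hn hsvd) mulmxK //.
rewrite unitmxE det_diag unitfE; apply/prodf_neq0 => i _.
by rewrite mxE expf_neq0 // gt_eqF.
Qed.

Lemma leading_explained_variance (R : realType) (N n : nat) (hn : (n <= N)%N)
    (G U V : 'M[R]_N) (lam : 'rV[R]_N) :
  is_distinct_svd G U V lam ->
  explained_variance G (first_cols hn U) =
  \sum_(i < n) lam 0 (widen_ord hn i) ^+ 2.
Proof.
move=> hsvd; rewrite /explained_variance -/(obsW G _) (leading_obsW hn hsvd).
rewrite mxtrace_mulC -/(obsTheta G _) (leading_obsTheta hn hsvd) mxtrace_diag.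
by apply: eq_bigr => i _; rewrite mxE.
Qed.

Lemma posterior_varianceE (R : realType) (N n : nat) (G : 'M[R]_N)
    (M : 'M[R]_(N, n)) :
  posterior_variance G M = \tr (covC G) - explained_variance G M.
Proof. exact: raddfB. Qed.

Lemma solves_B_iff_max (R : realType) (N n : nat) (G : 'M[R]_N)
    (M : 'M[R]_(N, n)) :
  solves_B G M <-> solves_B_max G M.
Proof.
by split=> -[rM opt]; split=> // M' /opt; rewrite !posterior_varianceE lerD2l lerN2.
Qed.

Lemma rank_orthonormal (R : realType) (N n : nat) (A : 'M[R]_(N, n)) :
  A^T *m A = 1%:M -> \rank A = n.
Proof.
move=> hA; apply/eqP; rewrite eqn_leq rank_leq_col /=.
by rewrite -{1}(mxrank1 R n) -hA mxrankM_maxr.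
Qed.

Lemma rank_singular_coordinates (R : realType) (N n : nat) (G U V : 'M[R]_N)
    (lam : 'rV[R]_N) (M : 'M[R]_(N, n)) :
  is_distinct_svd G U V lam -> \rank (diag_mx lam *m U^T *m M) = \rank M.
Proof.
move=> [[hU _ _ _] [_ lam0]]; rewrite eqmxMfull // row_full_unit unitmx_mul.
rewrite unitmxE det_diag unitfE; apply/andP; split.
  by apply/prodf_neq0 => i _; rewrite gt_eqF.
by have [] := mulmx1_unit hU.
Qed.

(** The two explained variances differ by a sum of nonnegative terms
(w i - t) ([i < n] - p i), with p the diagonal of the projector.  For i >= n the
factor w i - t is nonzero, so equality forces p i = 0, hence row [i] of
Lam U^T M is zero, and lam_i > 0 can be cancelled. *)
Lemma explained_variance_gap (R : realType) (N n : nat) (hN : (0 < N)%N)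
    (hn : (n <= N)%N) (G U V : 'M[R]_N) (lam : 'rV[R]_N) (M : 'M[R]_(N, n)) :
  is_distinct_svd G U V lam -> \rank M = n ->
  explained_variance G M <= explained_variance G (first_cols hn U) /\
  (explained_variance G (first_cols hn U) <= explained_variance G M ->
   forall (i : 'I_N) (j : 'I_n), (n <= i)%N -> (U^T *m M) i j = 0).
Proof.
move=> hsvd rM; have [_ [lam_decr lam0]] := hsvd.
set Q := diag_mx lam *m U^T *m M.
have rQ : \rank Q = n by rewrite (rank_singular_coordinates M hsvd).
pose w i := lam 0 i ^+ 2; pose p i := orthoproj Q i i.
have w_decr (i j : 'I_N) : (i < j)%N -> w j < w i.
  by move=> /lam_decr lt_ji; rewrite ltr_pXn2r ?nnegrE ?(ltW (lam0 _)).
have [t [w_head w_tail]] := exists_threshold hN hn w_decr.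
have p01 i : 0 <= p i <= 1 by rewrite orthoproj_diag_ge0 ?orthoproj_diag_le1.
have term_ge0 := threshold_terms_ge0 w_head w_tail p01.
have gap : explained_variance G (first_cols hn U) - explained_variance G M =
    \sum_(i < N) (w i - t) * ((i < n)%:R - p i).
  rewrite (leading_explained_variance hn hsvd) (explained_varianceE M hsvd).
  exact/threshold_gap/mxtrace_orthoproj.
split=> [|le_UM i j le_ni].
  by rewrite -subr_ge0 gap; apply: sumr_ge0 => i _; exact: term_ge0.
have /eqP : \sum_(i < N) (w i - t) * ((i < n)%:R - p i) = 0.
  by apply/le_anti; rewrite -{1}gap subr_le0 le_UM sumr_ge0.
rewrite psumr_eq0 // => /allP/(_ i (mem_index_enum i)).
rewrite /= ltnNge le_ni sub0r mulf_eq0 oppr_eq0 subr_eq0 lt_eqF ?w_tail //=.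
move=> /eqP/(orthoproj_diag_eq0 j rQ); rewrite /Q -mulmxA mul_diag_mx mxE.
by move/eqP; rewrite mulf_eq0 (gt_eqF (lam0 i)) => /eqP.
Qed.

Lemma leading_solves_B (R : realType) (N n : nat) (hN : (0 < N)%N)
    (hn : (n <= N)%N) (G U V : 'M[R]_N) (lam : 'rV[R]_N) :
  is_distinct_svd G U V lam -> solves_B G (first_cols hn U).
Proof.
move=> hsvd; have [[hU _ _ _] _] := hsvd; apply/solves_B_iff_max; split.
  exact/rank_orthonormal/first_cols_orthonormal.
by move=> M rM; have [] := explained_variance_gap hN hn hsvd rM.
Qed.

(** Only the first [n] coordinates of [M] in the basis [U] survive, so
M = Un (Un^T M); the inclusion of column spaces is an equality by rank. *)
Lemma leading_same_colspan (R : realType) (N n : nat) (hn : (n <= N)%N)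
    (U : 'M[R]_N) (M : 'M[R]_(N, n)) :
  orthogonal_mx U -> \rank M = n ->
  (forall (i : 'I_N) (j : 'I_n), (n <= i)%N -> (U^T *m M) i j = 0) ->
  same_colspan (first_cols hn U) M.
Proof.
move=> hU rM tail0; have ME : M = first_cols hn U *m ((first_cols hn U)^T *m M).
  rewrite -{1}[M]mul1mx -(orthogonal_mxC hU) -mulmxA.
  apply/matrixP => i j; rewrite [LHS]mxE [RHS]mxE.
  transitivity (\sum_(k < N) U i k * (U^T *m M) k j * (k < n)%:R).
    by apply: eq_bigr => k _; case: ltnP => [_|/tail0 ->]; rewrite ?mulr1 ?mulr0.
  rewrite -(sum_first hn (fun k => U i k * (U^T *m M) k j)).
  apply: eq_bigr => k _; rewrite !mxE; congr (_ * _).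
  by apply: eq_bigr => l _; rewrite !mxE.
rewrite /same_colspan andbC; have sub : (M^T <= (first_cols hn U)^T)%MS.
  by rewrite ME trmx_mul submxMl.
rewrite sub /= -(mxrank_leqif_sup sub) !mxrank_tr rM.
by rewrite rank_orthonormal ?first_cols_orthonormal.
Qed.

Lemma observe_leading (R : realType) (N n : nat) (hn : (n <= N)%N)
    (G U V : 'M[R]_N) (lam : 'rV[R]_N) (f : 'cV[R]_N) (i : 'I_n) :
  is_distinct_svd G U V lam ->
  observe (first_cols hn U) (G *m f) i 0 =
  lam 0 (widen_ord hn i) * dotv f (col (widen_ord hn i) V).
Proof.
move=> [[_ _ _ hGU] _]; set j := widen_ord hn i.
have <- : ((G^T *m U)^T *m f) j 0 = observe (first_cols hn U) (G *m f) i 0.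
  rewrite trmx_mul trmxK -mulmxA /observe !mxE.
  by apply: eq_bigr => k _; rewrite !mxE.
rewrite hGU trmx_mul tr_diag_mx -mulmxA mul_diag_mx mxE; congr (_ * _).
by rewrite mxE; apply: eq_bigr => k _; rewrite !mxE mulrC.
Qed.

Theorem theorem2p4 (R : realType) (N n : nat) (hN : (0 < N)%N) (hn : (n <= N)%N)
    (L G U V : 'M[R]_N) (lam : 'rV[R]_N)
    (hL : L \in unitmx) (hG : G = invmx L)
    (hsvd : is_distinct_svd G U V lam) :
  [/\ exists kappa : R, is_kolmogorov_width n G kappa,
      forall M : 'M[R]_(N, n), solves_B G M <-> solves_B_max G M,
      [/\ solves_B G (first_cols hn U),
          forall i : 'I_n,
            col i (obsW G (first_cols hn U)) = col (widen_ord hn i) U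
        & forall (f : 'cV[R]_N) (i : 'I_n),
            observe (first_cols hn U) (G *m f) i 0 =
            lam 0 (widen_ord hn i) * dotv f (col (widen_ord hn i) V)]
    & forall M : 'M[R]_(N, n),
        solves_B G M -> same_colspan (first_cols hn U) M].
Proof.
split.
- exact: kolmogorov_width_svd hsvd.
- exact: solves_B_iff_max.
- split.
  + exact: leading_solves_B hsvd.
  + by move=> i; rewrite (leading_obsW hn hsvd); apply/colP => k; rewrite !mxE.
  + by move=> f i; exact: observe_leading hsvd.
- have [[hU _ _ _] _] := hsvd.
  move=> M /solves_B_iff_max[rM opt]; apply: leading_same_colspan => //.
  have [_] := explained_variance_gap hN hn hsvd rM; apply; apply: opt.
  exact/rank_orthonormal/first_cols_orthonormal.
Qed.
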